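(* Let $X$ be an Hadamard space with dual space $X^*$, $A\colon X\to 2^{X^*}$ a monotone operator satisfying a range condition, and $J_A$ the resolvent of $A$. Then the following hold. (i) The set $A^{-1}(0)$ is nonempty if and only if $\{(J_A)^n x\}$ is bounded for some $x\in X$; (ii) if $A^{-1}(0)$ is nonempty, then $\{(J_A)^n x\}$ is $\Delta$-convergent to an element of $A^{-1}(0)$ for all $x\in X$.
   Context: Hadamard spaces: A metric space $(X,d)$ is uniquely geodesic if for all $x,y\in X$ there is a unique mapping $\gamma\colon[0,l]\to X$, $l=d(x,y)$, with $\gamma(0)=x$, $\gamma(l)=y$ and $d(\gamma(s),\gamma(t))=|s-t|$ for all $s,t\in[0,l]$; the point $\gamma(\alpha l)$ is denoted by $(1-\alpha)x\oplus\alpha y$ for $\alpha\in[0,1]$. A $\mathrm{CAT}(0)$ space is a uniquely geodesic metric space such that $d((1-\alpha)x\oplus\alpha y,(1-\beta)x\oplus\beta z)\leq |(1-\alpha)\bar x+\alpha\bar y-((1-\beta)\bar x+\beta\bar z)|_{\mathbb{R}^2}$ whenever $x,y,z\in X$, $\alpha,\beta\in[0,1]$ and $\bar x,\bar y,\bar z\in\mathbb{R}^2$ satisfy $d(x,y)=|\bar x-\bar y|_{\mathbb{R}^2}$, $d(y,z)=|\bar y-\bar z|_{\mathbb{R}^2}$, $d(z,x)=|\bar z-\bar x|_{\mathbb{R}^2}$ (Euclidean norm). An Hadamard space is a complete $\mathrm{CAT}(0)$ space. $\Delta$-convergence: The asymptotic center of a sequence $\{x_n\}$ in $X$ is $\mathcal{A}(\{x_n\})=\{u\in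 X : \limsup_n d(u,x_n)=\inf_{y\in X}\limsup_n d(y,x_n)\}$, upper limits being taken in $[0,\infty]$. The sequence $\{x_n\}$ is $\Delta$-convergent to $p\in X$ if $\mathcal{A}(\{x_{n_i}\})=\{p\}$ for each subsequence $\{x_{n_i}\}$ of $\{x_n\}$. Dual space: An element $(x,y)\in X^2$ is written $\overrightarrow{xy}$. The quasilinearization is $\langle \overrightarrow{xy},\overrightarrow{zw}\rangle=\frac12\left(d(x,w)^2+d(y,z)^2-d(x,z)^2-d(y,w)^2\right)$. Write $\alpha\overrightarrow{xy}$ for $(\alpha,\overrightarrow{xy})\in\mathbb{R}\times X^2$ and $\overrightarrow{xy}$ for $1\overrightarrow{xy}$. Define an equivalence relation on $\mathbb{R}\times X^2$ by $\alpha\overrightarrow{xy}\sim\beta\overrightarrow{zw}$ if and only if $\alpha\langle\overrightarrow{xy},\overrightarrow{pq}\rangle=\beta\langle\overrightarrow{zw},\overrightarrow{pq}\rangle$ for all $p,q\in X$. The dual space $X^*$ is the set of equivalence classes $[\alpha\overrightarrow{xy}]$; its origin is $0=[\overrightarrow{aa}]$ for a fixed $a\in X$ (independent of $a$). For $u^*=[\alpha\overrightarrow{xy}]\in X^*$ and $\overrightarrow{pq}\in X^2$ put $\langle u^*,\overrightarrow{pq}\rangle=\alpha\langle\overrightarrow{xy},\overrightarrow{pq}\rangle$ (well defined). Monotone operators: An operator $A\colon X\to 2^{X^*}$ is monotone if $\langle u^*,\overrightarrow{vu}\rangle-\langle v^*,\overrightarrow{vu}\rangle\geq 0$ whenever $u,v\in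 X$, $u^*\in Au$ and $v^*\in Av$. A monotone operator $A$ satisfies a range condition if for each $x\in X$ there exists $z\in X$ with $[\overrightarrow{zx}]\in Az$. In that case, the resolvent $J_A$ is defined by $J_A(x)=\{z\in X: [\overrightarrow{zx}]\in Az\}$ for $x\in X$, which is a single-valued mapping of $X$ into itself. The zero point set is $A^{-1}(0)=\{u\in X: 0\in Au\}$. *)

(* Defs.v *)
From HB Require Import structures.
From mathcomp Require Import all_boot all_order all_algebra.
From mathcomp Require Import generic_quotient.
From mathcomp Require Import all_classical all_reals all_analysis.
From mathcomp Require Import ring lra.

Set Implicit Arguments.
Unset Strict Implicit.
Unset Printing Implicit Defensive.

Import Order.TTheory GRing.Theory Num.Theory.
Import numFieldNormedType.Exports.

Local Open Scope classical_set_scope.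
Local Open Scope ring_scope.
Local Open Scope quotient_scope.

Section EuclideanPlane.
Context {R : realType}.

(* The norm that the library puts on 'rV[R]_2 is the sup norm. *)
Definition enorm (v : 'rV[R]_2) : R := Num.sqrt (\sum_(i < 2) v 0 i ^+ 2).

Definition edist (v w : 'rV[R]_2) : R := enorm (v - w).

End EuclideanPlane.

Section Hadamard.
Context {R : realType}.
Variable X : metricType R.
Implicit Types (x y z : X) (s t : R).

(* A map [0, d(x, y)] -> X is represented by a total map R -> X, of which only
   the values on [0, d(x, y)] matter. *)
Definition is_geodesic x y (g : R -> X) : Prop :=
  [/\ g 0 = x, g (mdist x y) = y
    & {in `[0, mdist x y] &, forall s t, mdist (g s) (g t) = `|s - t|}].

Definition uniquely_geodesic : Prop := forall x y,
  exists2 g, is_geodesic x y g &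
    forall h, is_geodesic x y h -> {in `[0, mdist x y], h =1 g}.

Definition geodesic x y : R -> X := xget (cst x) [set g | is_geodesic x y g].

(* The point (1 - a)x (+) a y, for a in [0, 1]. *)
Definition geocomb (a : R) x y : X := geodesic x y (a * mdist x y).

Definition cat0_ineq : Prop :=
  forall (x y z : X) (a b : R) (x' y' z' : 'rV[R]_2),
    a \in `[0, 1] -> b \in `[0, 1] ->
    mdist x y = edist x' y' ->
    mdist y z = edist y' z' ->
    mdist z x = edist z' x' ->
    mdist (geocomb a x y) (geocomb b x z) <=
      edist ((1 - a) *: x' + a *: y') ((1 - b) *: x' + b *: z').

Definition CAT0 : Prop := uniquely_geodesic /\ cat0_ineq.

(* completeType is not used because it carries a distinguished point. *)
Definition metric_complete : Prop := forall u : nat -> X,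
  cauchy (u @ \oo) -> exists l : X, u @ \oo --> l.

Definition hadamard : Prop := metric_complete /\ CAT0.

Lemma geodesicP x y : uniquely_geodesic -> is_geodesic x y (geodesic x y).
Proof.
move=> /(_ x y)[g xyg _].
exact: (@xgetPex _ (cst x) [set g | is_geodesic x y g] (ex_intro _ g xyg)).
Qed.

End Hadamard.

Section DeltaConvergence.
Context {R : realType} {X : metricType R}.
Implicit Types (u : nat -> X).

Definition bounded_metric_set (S : set X) : Prop :=
  exists M : R, forall y z, S y -> S z -> mdist y z <= M.

(* limsup_n d(y, u_n), in [0, +oo]. *)
Definition asymptotic_radius u (y : X) : \bar R :=
  limn_esup (fun n => (mdist y (u n))%:E).

Definition asymptotic_center u : set X :=
  [set y | asymptotic_radius u y = ereal_inf (range (asymptotic_radius u))].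

Definition delta_cvg u (p : X) : Prop :=
  forall phi : nat -> nat, increasing_seq phi ->
    asymptotic_center (u \o phi) = [set p].

End DeltaConvergence.

Section DualSpace.
Context {R : realType}.

Definition qlin {X : metricType R} (x y z w : X) : R :=
  2^-1 * (mdist x w ^+ 2 + mdist y z ^+ 2 - mdist x z ^+ 2 - mdist y w ^+ 2).

Variable X : metricType R.

(* (a, (x, y)) stands for a xy. *)
Definition scaled_vector : Type := (R * (X * X))%type.
HB.instance Definition _ := Choice.on scaled_vector.

Definition qlin_scaled (u : scaled_vector) (p q : X) : R :=
  u.1 * qlin u.2.1 u.2.2 p q.

Definition dual_eqv (u v : scaled_vector) : bool :=
  `[< forall p q : X, qlin_scaled u p q = qlin_scaled v p q >].

Lemma dual_eqv_equiv : equiv_class_of dual_eqv.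
Proof.
split=> [u|u v|v u w].
- exact/asboolP.
- by apply/asboolP/asboolP => uv p q.
- by move=> /asboolP uv /asboolP vw; apply/asboolP => p q; rewrite uv vw.
Qed.

Canonical dual_equiv := EquivRelPack dual_eqv_equiv.

Definition dual : Type := {eq_quot dual_equiv}.
HB.instance Definition _ := Choice.on dual.
HB.instance Definition _ := EqQuotient.on dual.

End DualSpace.

Section MonotoneOperators.
Context {R : realType} {X : metricType R}.
Implicit Types (x y p q : X) (A : X -> set (dual X)).

Definition dual_class (a : R) x y : dual X :=
  \pi_(dual X) ((a, (x, y)) : scaled_vector X).

Definition dual_origin (a : X) : dual X := dual_class 1 a a.

Definition pairing (f : dual X) p q : R := qlin_scaled (repr f) p q.

Lemma pairingE (a : R) x y p q :
  pairing (dual_class a x y) p q = a * qlin x y p q.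
Proof.
rewrite /pairing /dual_class.
have : \pi_(dual X) (repr (\pi_(dual X) ((a, (x, y)) : scaled_vector X)))
  = \pi_(dual X) ((a, (x, y)) : scaled_vector X) by rewrite reprK.
by move=> /eqmodP/asboolP ->.
Qed.

Lemma dual_classP (a b : R) x y z w :
  dual_class a x y = dual_class b z w <->
  forall p q, a * qlin x y p q = b * qlin z w p q.
Proof.
split=> [xyzw p q|xyzw]; first by rewrite -!pairingE xyzw.
exact/eqmodP/asboolP.
Qed.

Lemma dual_origin_indep (a b : X) : dual_origin a = dual_origin b.
Proof. by apply/dual_classP => p q; rewrite /qlin; ring. Qed.

Definition monotone_operator A : Prop :=
  forall (u v : X) (f g : dual X), A u f -> A v g ->
    0 <= pairing f v u - pairing g v u.

Definition range_condition A : Prop :=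
  forall x, exists z, A z (dual_class 1 z x).

Definition resolvent_set A x : set X := [set z | A z (dual_class 1 z x)].

(* By resolvent_setE, resolvent_set A x is the singleton of this point as soon
   as A is monotone and satisfies the range condition. *)
Definition resolvent A x : X := xget x (resolvent_set A x).

Definition zeros (a : X) A : set X := [set u | A u (dual_origin a)].

Lemma resolvent_setE A x : monotone_operator A -> range_condition A ->
  resolvent_set A x = [set resolvent A x].
Proof.
move=> mA rA; have Jx : resolvent_set A x (resolvent A x).
  by apply: xgetPex; have [z] := rA x; exists z.
apply/seteqP; split => [z Jz /=|_ -> //].
have := mA _ _ _ _ Jz Jx; rewrite !pairingE /qlin !mdistxx.
rewrite (metric_sym (resolvent A x) z) => h.
apply: mdist_positivity; apply/eqP; rewrite -sqrf_eq0 eq_le sqr_ge0 andbT.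
by lra.
Qed.

End MonotoneOperators.

(* Main.v *)
Require Import Defs.
From mathcomp Require Import all_boot all_order all_algebra.
From mathcomp Require Import all_classical all_reals all_analysis.
From mathcomp Require Import ring lra.

Set Implicit Arguments.
Unset Strict Implicit.
Unset Printing Implicit Defensive.

Import Order.TTheory GRing.Theory Num.Theory.
Import numFieldNormedType.Exports.

Local Open Scope classical_set_scope.
Local Open Scope ring_scope.

(** Write [T] for the resolvent. Two facts turn the theorem into fixed point
    theory. By [zeros_resolvent], the zeros of [A] are the fixed points of [T];
    and writing out the monotonicity of [A] at [T x] and [T y] gives the
    inequality [firmly_nonspreading],
      2 d(Tx,Ty)^2 + d(x,Tx)^2 + d(y,Ty)^2 <= d(x,Ty)^2 + d(y,Tx)^2.

    The geometry of the space enters only through the Bruhat-Tits (CN)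
    inequality for midpoints. It passes from the squared distances to the
    squared asymptotic radius r_v(y) = limsup_n d(y, v_n), which is therefore a
    uniformly convex function of y, and by completeness it has exactly one
    minimizer: a bounded sequence has exactly one asymptotic center
    ([asymptotic_center_set1]).

    Let p be the asymptotic center of v, and assume that v and T v have the
    same asymptotic radii. The upper limit of the inequality at p and v_n gives
      2 r_v(Tp)^2 + d(p,Tp)^2 <= r_v(Tp)^2 + r_v(p)^2,
    and as r_v(p) <= r_v(Tp), it follows that Tp = p
    ([asymptotic_center_fixed]). The hypothesis on the radii holds for a bounded
    orbit, because T v is then a shift of v; this gives a zero. It also holds
    for every subsequence of an orbit as soon as T has a fixed point u: then
      d(u,Tx)^2 + d(x,Tx)^2 <= d(u,x)^2,
    so the squared steps of the orbit have a finite sum and the steps tend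
    to 0.

    For the Delta-convergence, let p and q be the asymptotic centers of an orbit
    and of one of its subsequences; both are fixed points. The distances from
    the orbit to a fixed point decrease, so they have the same upper limit along
    the orbit and along the subsequence. Hence q minimizes the asymptotic radius
    of the whole orbit, and q = p by uniqueness. *)

(** * The CN inequality for midpoints *)

Section PlanePoints.
Context {R : realType}.
Implicit Types a b c d k : R.

Definition plane_point a b : 'rV[R]_2 := \row_i [:: a; b]`_i.

Lemma edist_plane_point a b c d :
  Defs.edist (plane_point a b) (plane_point c d) =
  Num.sqrt ((a - c) ^+ 2 + (b - d) ^+ 2).
Proof.
by rewrite /Defs.edist /enorm !big_ord_recl big_ord0 !mxE /= addr0.
Qed.

Lemma scale_plane_point k a b :
  k *: plane_point a b = plane_point (k * a) (k * b).
Proof. by apply/rowP => -[[|[|//]] i2]; rewrite !mxE. Qed.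

Lemma add_plane_point a b c d :
  plane_point a b + plane_point c d = plane_point (a + c) (b + d).
Proof. by apply/rowP => -[[|[|//]] i2]; rewrite !mxE. Qed.

(** A triangle with sides [a], [b], [c] can be drawn in the plane with the side
    [c] on the first axis: the cosine law gives the abscissa [s] of the third
    vertex, and the triangle inequalities say that [s ^+ 2 <= b ^+ 2]. *)
Lemma comparison_apex a b c : 0 <= a -> 0 <= b -> 0 < c ->
  a <= b + c -> b <= a + c -> c <= a + b ->
  exists s t, s ^+ 2 + t ^+ 2 = b ^+ 2 /\ (c - s) ^+ 2 + t ^+ 2 = a ^+ 2.
Proof.
move=> a0 b0 c0 abc bac cab.
pose s := (b ^+ 2 + c ^+ 2 - a ^+ 2) / (2 * c).
have cs : 2 * c * s = b ^+ 2 + c ^+ 2 - a ^+ 2.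
  by rewrite /s mulrC divfK// mulf_neq0// ?pnatr_eq0// gt_eqF.
have sb : s ^+ 2 <= b ^+ 2.
  (* These products are (b + c)^2 - a^2 and a^2 - (b - c)^2, that is
     2c(b + s) and 2c(b - s). *)
  have h1 : 0 <= (b + c - a) * (b + c + a) by apply: mulr_ge0; lra.
  have h2 : 0 <= (a + c - b) * (a + b - c) by apply: mulr_ge0; lra.
  have k1 : 0 <= b + s by rewrite -(pmulr_rge0 _ (_ : 0 < 2 * c)); nra.
  have k2 : 0 <= b - s by rewrite -(pmulr_rge0 _ (_ : 0 < 2 * c)); nra.
  have := mulr_ge0 k1 k2; nra.
exists s, (Num.sqrt (b ^+ 2 - s ^+ 2)).
by rewrite sqr_sqrtr ?subr_ge0//; split; lra.
Qed.

End PlanePoints.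

Section HadamardGeometry.
Context {R : realType} {X : metricType R}.
Implicit Types (x y z : X).

Definition has_CN_midpoints := forall x y, exists m, forall z,
  mdist m z ^+ 2 <=
  2^-1 * mdist x z ^+ 2 + 2^-1 * mdist y z ^+ 2 - 4^-1 * mdist x y ^+ 2.

(** In the Euclidean plane the inequality is an equality, the parallelogram law;
    the CAT(0) inequality for the midpoint of one side and the opposite vertex
    carries it over. *)
Lemma CAT0_CN_midpoints : CAT0 X -> has_CN_midpoints.
Proof.
move=> [ugX catX] x y; have [->|xy] := eqVneq x y.
  by exists y => z; rewrite mdistxx; lra.
exists (geocomb 2^-1 x y) => z.
have geo1 : geocomb 1 x z = z.
  by rewrite /geocomb mul1r; have [] := geodesicP x z ugX.
have xyz := metric_triangle y x z; have yxz := metric_triangle x y z.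
have zxy := metric_triangle x z y.
rewrite (metric_sym y x) in xyz; rewrite (metric_sym z y) in zxy.
have [||||||s [t [st1 st2]]] := @comparison_apex _ (mdist y z) (mdist x z) (mdist x y).
- exact: mdist_ge0.
- exact: mdist_ge0.
- by rewrite mdist_gt0.
- by lra.
- by lra.
- by lra.
have := catX x y z 2^-1 1 (plane_point 0 0) (plane_point (mdist x y) 0) (plane_point s t).
rewrite geo1 !scale_plane_point !add_plane_point !edist_plane_point.
have -> : 2^-1 \in `[(0 : R), 1] by rewrite in_itv /=; lra.
have -> : 1 \in `[(0 : R), 1] by rewrite in_itv /=; lra.
move=> /(_ isT isT).
rewrite !(subr0, sub0r, oppr0, sqrrN, expr0n, addr0).
rewrite st1 st2 !sqrtr_sqr !ger0_norm ?mdist_ge0// (metric_sym z x).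
move=> /(_ erefl erefl erefl).
set e := Num.sqrt _ => me.
have : mdist (geocomb 2^-1 x y) z ^+ 2 <= e ^+ 2.
  by rewrite lerXn2r// nnegrE ?mdist_ge0// sqrtr_ge0.
rewrite /e sqr_sqrtr ?addr_ge0 ?sqr_ge0// => /le_trans; apply.
lra.
Qed.

(** The values of [rho] at two near-minimizers and at their midpoint bound the
    distance of the two points, so a minimizing sequence is Cauchy; the same
    bound gives uniqueness. *)
Lemma strongly_convex_argmin (rho : X -> R) (x0 : X) :
  metric_complete X -> (forall x, 0 <= rho x) ->
  (forall x y, rho x <= rho y + mdist x y) ->
  (forall x y, exists m, rho m ^+ 2 <=
     2^-1 * rho x ^+ 2 + 2^-1 * rho y ^+ 2 - 4^-1 * mdist x y ^+ 2) ->
  exists2 p, forall x, rho p <= rho x &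
    forall q, (forall x, rho q <= rho x) -> q = p.
Proof.
move=> complX rho0 lip conv.
pose S := range rho.
have infS : has_inf S.
  by split; [exists (rho x0), x0 | exists 0 => _ [x _ <-]].
pose r := inf S.
have rle x : r <= rho x by apply: (ge_inf infS.2); exists x.
have r0 : 0 <= r.
  by apply: lb_le_inf; [exact: infS.1|move=> _ [x _ <-]].
have spread x y : mdist x y ^+ 2 <= 2 * (rho x ^+ 2 - r ^+ 2) + 2 * (rho y ^+ 2 - r ^+ 2).
  have [m hm] := conv x y.
  have : r ^+ 2 <= rho m ^+ 2 by rewrite lerXn2r// nnegrE.
  lra.
have /boolp.choice[u uP] n : exists x, rho x ^+ 2 < r ^+ 2 + n.+1%:R^-1.
  have n0 : 0 < n.+1%:R^-1 :> R by rewrite invr_gt0.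
  have rlt : r < Num.sqrt (r ^+ 2 + n.+1%:R^-1).
    rewrite -[X in X < _]ger0_norm// -sqrtr_sqr ltr_sqrt ?ltrDl//.
    by rewrite ltr_wpDl// sqr_ge0.
  have [_ [x _ <-] xlt] := inf_lt infS.1 rlt.
  exists x; rewrite -[ltRHS]sqr_sqrtr ?addr_ge0 ?sqr_ge0 ?(ltW n0)//.
  by rewrite ltrXn2r// nnegrE// sqrtr_ge0.
have small e : 0 < e -> \forall n \near \oo, rho (u n) ^+ 2 - r ^+ 2 < e.
  move=> e0; have := near_infty_natSinv_lt (PosNum e0).
  by apply: filterS => n /= ne; rewrite ltrBlDl (lt_trans (uP n))// ltrD2l.
have cauchyu : cauchy (u @ \oo).
  apply/cauchy_ballP => e e0; have e40 : 0 < e ^+ 2 / 4 by rewrite divr_gt0// exprn_gt0.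
  rewrite near_simpl; near=> m n; rewrite /= ballEmdist /=.
  rewrite -(@ltr_pXn2r _ 2)// ?nnegrE ?mdist_ge0 ?(ltW e0)//.
  have hm : rho (u m) ^+ 2 - r ^+ 2 < e ^+ 2 / 4 by near: m; exact: small.
  have hn : rho (u n) ^+ 2 - r ^+ 2 < e ^+ 2 / 4 by near: n; exact: small.
  by have := spread (u m) (u n); lra.
have [p up] := complX u cauchyu.
have pr : rho p <= r.
  apply/ler_addgt0Pr => e e0; have e20 : 0 < e / 2 by lra.
  have e24 : 0 < (e / 2) ^+ 2 by rewrite exprn_gt0.
  near \oo => n.
  have pn : mdist p (u n) < e / 2.
    have : ball p (e / 2) (u n) by near: n; exact: (cvg_ball up).
    by rewrite ballEmdist.
  have un : rho (u n) <= r + e / 2.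
    rewrite -(@ler_pXn2r _ 2)// ?nnegrE ?addr_ge0 ?(ltW e20)//.
    have : rho (u n) ^+ 2 - r ^+ 2 < (e / 2) ^+ 2 by near: n; exact: small.
    by nra.
  by have := lip p (u n); lra.
have pE : rho p = r by apply/eqP; rewrite eq_le pr rle.
exists p => [x|q qmin]; first by rewrite pE.
have qE : rho q = r by apply/eqP; rewrite eq_le rle -pE qmin.
apply: mdist_positivity; apply/eqP; rewrite -sqrf_eq0 eq_le sqr_ge0 andbT.
by have := spread q p; rewrite pE qE; lra.
Unshelve. all: by end_near. Qed.

End HadamardGeometry.

(** * Asymptotic radii and asymptotic centers *)

Section AsymptoticRadius.
Context {R : realType} {X : metricType R}.
Implicit Types (u v : nat -> X) (x y z p : X) (c e : R).

(** The asymptotic radii of a bounded sequence are finite; as real numbers they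
    can be squared and compared by linear arithmetic. *)
Definition real_asymptotic_radius u y : R := fine (asymptotic_radius u y).

Local Notation rad := real_asymptotic_radius.

Lemma asymptotic_radius_leP u y c : (asymptotic_radius u y <= c%:E)%E <->
  forall e, 0 < e -> \forall n \near \oo, mdist y (u n) <= c + e.
Proof.
rewrite /asymptotic_radius /limn_esup limf_esupE; split=> [uc e e0|uc].
  have : (c%:E < (c + e)%:E)%E by rewrite lte_fin ltrDl.
  move=> /(le_lt_trans uc)/ereal_inf_lt[_ [V FV <-]] /ltW Vce.
  apply: filterS FV => n Vn; rewrite -lee_fin; apply: le_trans Vce.
  by apply: ereal_sup_ubound; exists n.
apply/lee_addgt0Pr => e e0.
apply: (@le_trans _ _ (ereal_sup
    ((fun n => (mdist y (u n))%:E) @` [set n | mdist y (u n) <= c + e]))).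
  by apply: ereal_inf_lbound; exists [set n | mdist y (u n) <= c + e] => //;
    exact: uc.
by apply: ge_ereal_sup => _ [n /= nce <-]; rewrite -EFinD lee_fin.
Qed.

Lemma mdist_bounded_seq u y : bounded_metric_set (range u) ->
  exists M, forall n, mdist y (u n) <= M.
Proof.
move=> [M uM]; exists (mdist y (u 0%N) + M) => n.
by rewrite (le_trans (metric_triangle _ (u 0%N) _))// lerD2l uM.
Qed.

Lemma asymptotic_radiusE u y : bounded_metric_set (range u) ->
  asymptotic_radius u y = (rad u y)%:E.
Proof.
move=> /(mdist_bounded_seq y)[M uM]; rewrite fineK// ge0_fin_numE.
  apply: le_lt_trans (ltry M); apply/asymptotic_radius_leP => e e0.
  by apply: nearW => n; rewrite (le_trans (uM n))// lerDl ltW.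
apply: limf_esup_ge0 => [|n]; last by rewrite lee_fin mdist_ge0.
by move=> [N _ /(_ N)]; apply; rewrite /= leqnn.
Qed.

Lemma radius_leP u y c : bounded_metric_set (range u) ->
  rad u y <= c <->
  forall e, 0 < e -> \forall n \near \oo, mdist y (u n) <= c + e.
Proof.
by move=> bu; rewrite -lee_fin -asymptotic_radiusE//; exact: asymptotic_radius_leP.
Qed.

Lemma radius_ge0 u y : bounded_metric_set (range u) -> 0 <= rad u y.
Proof.
move=> bu; apply/ler_addgt0Pr => e e0.
have /radius_leP-/(_ bu e e0) := lexx (rad u y).
by move=> [N _ /(_ N (leqnn N))]; apply: le_trans; exact: mdist_ge0.
Qed.

(** The inequalities of CAT(0) geometry are linear in the squared distances, and
    this lemma lets an inequality between them pass to the upper limit. *)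
Lemma radius_sqr_leP u y c : bounded_metric_set (range u) ->
  rad u y ^+ 2 <= c <->
  forall e, 0 < e -> \forall n \near \oo, mdist y (u n) ^+ 2 <= c + e.
Proof.
move=> bu; have r0 := radius_ge0 y bu; split=> [rc e e0|uc].
  have c0 : 0 <= c + e by rewrite addr_ge0 ?(ltW e0)// (le_trans _ rc) ?sqr_ge0.
  have rs : rad u y < Num.sqrt (c + e).
    rewrite -(@ltr_pXn2r _ 2)// ?nnegrE ?sqrtr_ge0// sqr_sqrtr//.
    by rewrite (le_lt_trans rc)// ltrDl.
  have [+ _] := radius_leP y (rad u y) bu.
  move=> /(_ (lexx _) (Num.sqrt (c + e) - rad u y)).
  rewrite subr_gt0 => /(_ rs); apply: filterS => n; rewrite addrC subrK => nce.
  by rewrite -(sqr_sqrtr c0) lerXn2r// nnegrE ?mdist_ge0 ?sqrtr_ge0.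
apply/ler_addgt0Pr => e e0; have unc := uc e e0.
have c0 : 0 <= c + e.
  by have [N _ /(_ N (leqnn N))] := unc; apply: le_trans; exact: sqr_ge0.
rewrite -(sqr_sqrtr c0) lerXn2r// ?nnegrE ?sqrtr_ge0//.
apply/(radius_leP _ _ bu) => d d0; apply: filterS unc => n nc.
rewrite (@le_trans _ _ (Num.sqrt (c + e)))// ?lerDl ?(ltW d0)//.
by rewrite -(@ler_pXn2r _ 2)// ?nnegrE ?sqrtr_ge0 ?mdist_ge0// sqr_sqrtr.
Qed.

Lemma near_mdist_radius_sqr u y e : bounded_metric_set (range u) -> 0 < e ->
  \forall n \near \oo, mdist y (u n) ^+ 2 <= rad u y ^+ 2 + e.
Proof. by move=> bu; exact: (radius_sqr_leP y _ bu).1. Qed.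

Lemma radius_lipschitz u x y : bounded_metric_set (range u) ->
  rad u x <= rad u y + mdist x y.
Proof.
move=> bu; apply/(radius_leP _ _ bu) => e e0.
have : \forall n \near \oo, mdist y (u n) <= rad u y + e.
  exact: (radius_leP y _ bu).1.
by apply: filterS => n; have := metric_triangle x y (u n); lra.
Qed.

Lemma radius_CN u x y m : bounded_metric_set (range u) ->
  (forall z, mdist m z ^+ 2 <=
    2^-1 * mdist x z ^+ 2 + 2^-1 * mdist y z ^+ 2 - 4^-1 * mdist x y ^+ 2) ->
  rad u m ^+ 2 <=
    2^-1 * rad u x ^+ 2 + 2^-1 * rad u y ^+ 2 - 4^-1 * mdist x y ^+ 2.
Proof.
move=> bu mP; apply/(radius_sqr_leP _ _ bu) => e e0; near=> n.
have xn : mdist x (u n) ^+ 2 <= rad u x ^+ 2 + e.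
  by near: n; exact: near_mdist_radius_sqr.
have yn : mdist y (u n) ^+ 2 <= rad u y ^+ 2 + e.
  by near: n; exact: near_mdist_radius_sqr.
by have := mP (u n); lra.
Unshelve. all: by end_near. Qed.

Lemma asymptotic_centerP u p : bounded_metric_set (range u) ->
  asymptotic_center u p <-> forall y, rad u p <= rad u y.
Proof.
move=> bu; split=> [/= pu y|pmin /=].
  rewrite -lee_fin -!asymptotic_radiusE// pu.
  by apply: ereal_inf_lbound; exists y.
apply/eqP; rewrite eq_le; apply/andP; split.
  by apply: le_ereal_inf_tmp => _ [y _ <-]; rewrite !asymptotic_radiusE// lee_fin.
by apply: ereal_inf_lbound; exists p.
Qed.

Lemma asymptotic_center_set1 u : hadamard X -> bounded_metric_set (range u) ->
  exists p, asymptotic_center u = [set p].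
Proof.
move=> [complX /CAT0_CN_midpoints CN] bu.
have [|||p pmin puniq] := @strongly_convex_argmin _ _ (rad u) (u 0%N) complX.
- by move=> x; exact: radius_ge0.
- by move=> x y; exact: radius_lipschitz.
- by move=> x y; have [m mP] := CN x y; exists m; exact: radius_CN.
exists p; apply/seteqP; split=> [q /(asymptotic_centerP _ bu)/puniq //|_ ->].
exact/asymptotic_centerP.
Qed.

Lemma radius_shift u y : bounded_metric_set (range u) ->
  bounded_metric_set (range (fun n => u n.+1)) ->
  rad (fun n => u n.+1) y = rad u y.
Proof.
move=> bu bSu; apply/eqP; rewrite eq_le; apply/andP; split.
  apply/radius_leP => // e e0.
  have [+ _] := radius_leP y (rad u y) bu => /(_ (lexx _) e e0)[N _ uN].
  by exists N => // n /leqW; exact: uN.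
apply/radius_leP => // e e0; apply: near_inftyS.
exact: (radius_leP y _ bSu).1.
Qed.

Lemma radius_asymptotic_le u v y : bounded_metric_set (range u) ->
  bounded_metric_set (range v) ->
  (fun n => mdist (u n) (v n)) @ \oo --> (0 : R) -> rad u y <= rad v y.
Proof.
move=> bu bv uv; apply/radius_leP => // e e0; have e20 : 0 < e / 2 by lra.
near=> n.
have uvn : mdist (u n) (v n) < e / 2.
  rewrite -[ltLHS]ger0_norm ?mdist_ge0//; near: n.
  by move/cvgr0_norm_lt: uv; exact.
have vn : mdist y (v n) <= rad v y + e / 2.
  by near: n; exact: (radius_leP y _ bv).1.
have := metric_triangle y (v n) (u n); rewrite (metric_sym (v n) (u n)); lra.
Unshelve. all: by end_near. Qed.

Lemma increasing_seq_geid (phi : nat -> nat) n : increasing_seq phi ->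
  (n <= phi n)%N.
Proof.
move=> /increasing_seqP phiS; elim: n => // n IHn.
exact: leq_ltn_trans IHn (phiS n).
Qed.

Lemma radius_subseq_le u phi y : bounded_metric_set (range u) ->
  bounded_metric_set (range (u \o phi)) -> increasing_seq phi ->
  rad (u \o phi) y <= rad u y.
Proof.
move=> bu bphi iphi; apply/radius_leP => // e e0.
have [+ _] := radius_leP y (rad u y) bu => /(_ (lexx _) e e0)[N _ uN].
exists N => // n /= Nn; apply: uN; rewrite /= (leq_trans Nn)//.
exact: increasing_seq_geid.
Qed.

(** A bound on a decreasing sequence of distances at one index of the
    subsequence holds at all later indices. *)
Lemma radius_subseq_nonincreasing u phi y : bounded_metric_set (range u) ->
  bounded_metric_set (range (u \o phi)) ->
  nonincreasing_seq (fun n => mdist y (u n)) ->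
  rad u y <= rad (u \o phi) y.
Proof.
move=> bu bphi dec; apply/radius_leP => // e e0.
have [+ _] := radius_leP y (rad (u \o phi) y) bphi => /(_ (lexx _) e e0)[N _ uN].
exists (phi N) => // n /= Nn; apply: le_trans (uN N (leqnn N)).
exact: dec.
Qed.

End AsymptoticRadius.

(** * Fixed points of firmly nonspreading mappings *)

Section FirmlyNonspreading.
Context {R : realType} {X : metricType R}.
Implicit Types (x y u p : X) (T : X -> X).

Definition firmly_nonspreading T := forall x y,
  2 * mdist (T x) (T y) ^+ 2 + mdist x (T x) ^+ 2 + mdist y (T y) ^+ 2 <=
  mdist x (T y) ^+ 2 + mdist y (T x) ^+ 2.

Local Notation rad := real_asymptotic_radius.

(** The term [mdist p (T p) ^+ 2] in the defining inequality makes the radius at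
    [T p] strictly smaller than the minimal radius, unless [T p = p]. *)
Lemma asymptotic_center_fixed T (v : nat -> X) p : firmly_nonspreading T ->
  bounded_metric_set (range v) -> bounded_metric_set (range (T \o v)) ->
  (forall y, rad (T \o v) y = rad v y) ->
  asymptotic_center v p -> T p = p.
Proof.
move=> fT bv bTv radTv /asymptotic_centerP-/(_ bv) pmin.
suff : 2 * rad v (T p) ^+ 2 + mdist p (T p) ^+ 2 <=
    rad v (T p) ^+ 2 + rad v p ^+ 2.
  have : rad v p ^+ 2 <= rad v (T p) ^+ 2.
    by rewrite lerXn2r// ?nnegrE ?radius_ge0.
  move=> pTp h; apply/esym/mdist_positivity/eqP.
  by rewrite -sqrf_eq0 eq_le sqr_ge0 andbT; lra.
suff : rad (T \o v) (T p) ^+ 2 <=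
    2^-1 * (rad v (T p) ^+ 2 + rad v p ^+ 2 - mdist p (T p) ^+ 2).
  by rewrite radTv; lra.
apply/radius_sqr_leP => // e e0; near=> n.
have vn : mdist (T p) (v n) ^+ 2 <= rad v (T p) ^+ 2 + e.
  by near: n; exact: near_mdist_radius_sqr.
have Tvn : mdist p (T (v n)) ^+ 2 <= rad v p ^+ 2 + e.
  by rewrite -radTv; near: n; exact: near_mdist_radius_sqr.
have := fT p (v n); rewrite (metric_sym (v n) (T p)) /=.
by have := sqr_ge0 (mdist (v n) (T (v n))); lra.
Unshelve. all: by end_near. Qed.

Lemma fejer_fixed T x u : firmly_nonspreading T -> T u = u ->
  mdist u (T x) ^+ 2 + mdist x (T x) ^+ 2 <= mdist u x ^+ 2.
Proof.
move=> fT Tu; have := fT x u; rewrite Tu mdistxx.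
by rewrite (metric_sym (T x) u) (metric_sym x u); lra.
Qed.

Lemma orbit_fejer T x u : firmly_nonspreading T -> T u = u ->
  nonincreasing_seq (fun n => mdist u (iter n T x)).
Proof.
move=> fT Tu; apply/nonincreasing_seqP => n.
rewrite -(@ler_pXn2r _ 2)// ?nnegrE ?mdist_ge0// iterS.
have := fejer_fixed (iter n T x) fT Tu.
by have := sqr_ge0 (mdist (iter n T x) (T (iter n T x))); lra.
Qed.

(** The squared length of each step is at most the drop of a decreasing sequence
    that is bounded below, the squared distances to the fixed point [u]. *)
Lemma orbit_asymptotically_regular T x u : firmly_nonspreading T -> T u = u ->
  (fun n => mdist (T (iter n T x)) (iter n T x)) @ \oo --> (0 : R).
Proof.
move=> fT Tu; pose a n := mdist u (iter n T x) ^+ 2.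
have deca : nonincreasing_seq a.
  move=> m n mn; rewrite lerXn2r// ?nnegrE ?mdist_ge0//.
  exact: (orbit_fejer x fT Tu mn).
have al : a @ \oo --> inf (range a).
  by apply: nonincreasing_cvgn => //; exists 0 => _ [n _ <-]; exact: sqr_ge0.
have : a \- (fun n => a n.+1) @ \oo --> inf (range a) - inf (range a).
  by apply: cvgB => //; rewrite (cvg_shiftS a).
rewrite subrr => /cvgr0_norm_lt small; apply/cvgr0Pnorm_lt => e e0.
have := small _ (exprn_gt0 2 e0); apply: filterS => n /ltr_normlW an.
rewrite ger0_norm ?mdist_ge0// -(@ltr_pXn2r _ 2)// ?nnegrE ?mdist_ge0 ?(ltW e0)//.
have := fejer_fixed (iter n T x) fT Tu; rewrite (metric_sym (T _)).
by move: an; rewrite /= /a /=; lra.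
Qed.

(** On an orbit, [T] acts as a shift, which does not change the radii. *)
Lemma bounded_orbit_fixed T x : hadamard X -> firmly_nonspreading T ->
  bounded_metric_set (range (fun n => iter n T x)) -> exists p, T p = p.
Proof.
move=> hX fT bx; have [p xp] := asymptotic_center_set1 hX bx.
have bTx : bounded_metric_set (range (fun n => iter n.+1 T x)).
  have [M xM] := bx; exists M => _ _ [m _ <-] [n _ <-].
  by apply: xM; [exists m.+1|exists n.+1].
exists p; apply: (@asymptotic_center_fixed T (fun n => iter n T x)) => //.
  by move=> y; exact: (@radius_shift _ _ (fun n => iter n T x)).
by rewrite xp.
Qed.

(** The center of a subsequence is a fixed point, hence its distances to the
    orbit converge, and its radius with respect to the subsequence is the one
    with respect to the orbit. So it also minimizes the latter. *)
Lemma orbit_delta_cvg T x u : hadamard X -> firmly_nonspreading T -> T u = u ->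
  exists2 p, T p = p & delta_cvg (fun n => iter n T x) p.
Proof.
move=> hX fT Tu; pose o n := iter n T x.
have bsub (phi : nat -> nat) : bounded_metric_set (range (o \o phi)).
  exists (2 * mdist u x) => _ _ [m _ <-] [n _ <-] /=.
  have := orbit_fejer x fT Tu (leq0n (phi m)).
  have := orbit_fejer x fT Tu (leq0n (phi n)).
  have := metric_triangle (o (phi m)) u (o (phi n)).
  by rewrite (metric_sym (o (phi m)) u) /o /=; lra.
have bo : bounded_metric_set (range o) := bsub id.
(* The steps tend to 0, so T does not change the radii of a subsequence. *)
have center_fix phi q : increasing_seq phi -> asymptotic_center (o \o phi) q ->
    T q = q.
  move=> iphi; have bT : bounded_metric_set (range (T \o (o \o phi))).
    exact: (bsub (fun n => (phi n).+1)).
  have phioo : phi @ \oo --> \oo.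
    apply/cvgnyPge => N; exists N => // n /= Nn.
    by rewrite (leq_trans Nn)// increasing_seq_geid.
  have regphi := cvg_comp _ _ phioo (orbit_asymptotically_regular x fT Tu).
  apply: asymptotic_center_fixed => // y; apply/eqP.
  rewrite eq_le !radius_asymptotic_le//.
  by under eq_fun do rewrite metric_sym.
have [p op] := asymptotic_center_set1 hX bo.
have opp : asymptotic_center o p by rewrite op.
have Tp : T p = p by apply: (center_fix id).
exists p => // phi iphi; have [q oq] := asymptotic_center_set1 hX (bsub phi).
rewrite -/o oq; congr set1; suff: asymptotic_center o q by rewrite op.
have oqq : asymptotic_center (o \o phi) q by rewrite oq.
have Tq := center_fix _ _ iphi oqq.
apply/asymptotic_centerP => // y.
rewrite (le_trans (radius_subseq_nonincreasing bo (bsub phi) (orbit_fejer x fT Tq)))//.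
rewrite (le_trans ((asymptotic_centerP _ (bsub phi)).1 oqq p))//.
rewrite (le_trans (radius_subseq_le p bo (bsub phi) iphi))//.
exact: (asymptotic_centerP _ bo).1.
Qed.

End FirmlyNonspreading.

(** * The resolvent of a monotone operator *)

Section Resolvent.
Context {R : realType} {X : metricType R}.
Variables (A : X -> set (dual X)).
Hypotheses (monoA : monotone_operator A) (rangeA : range_condition A).

Lemma resolvent_firmly_nonspreading : firmly_nonspreading (resolvent A).
Proof.
have res x : A (resolvent A x) (dual_class 1 (resolvent A x) x).
  have : resolvent_set A x (resolvent A x) by rewrite resolvent_setE.
  by [].
move=> x y; have := monoA (res x) (res y); rewrite !pairingE /qlin !mdistxx.
rewrite (metric_sym (resolvent A y) (resolvent A x)); lra.
Qed.

(** The origin of the dual space is also the class of the vector from [u] to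
    [u], so it lies in [A u] exactly when [u] solves the inclusion defining the
    resolvent at [u]. *)
Lemma zeros_resolvent (a u : X) : zeros a A u <-> resolvent A u = u.
Proof.
have -> : zeros a A u = resolvent_set A u u.
  by rewrite /zeros /= (dual_origin_indep a u).
by rewrite resolvent_setE//; split=> /= <-.
Qed.

End Resolvent.

Theorem corollary6p2 (R : realType) (X : metricType R) (hX : hadamard X)
    (a : X) (A : X -> set (dual X))
    (monoA : monotone_operator A) (rangeA : range_condition A) :
  (zeros a A !=set0 <->
     exists x : X, bounded_metric_set (range (fun n => iter n (resolvent A) x)))
  /\
  (zeros a A !=set0 -> forall x : X,
     exists2 p : X, zeros a A p & delta_cvg (fun n => iter n (resolvent A) x) p).
Proof.
have zeroP := zeros_resolvent monoA rangeA a.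
have fJ := resolvent_firmly_nonspreading monoA rangeA.
split; first split=> [[u /zeroP Ju]|[x bx]].
- exists u, 0 => _ _ [m _ <-] [n _ <-].
  by rewrite !iter_fix// mdistxx.
- by have [p Jp] := bounded_orbit_fixed hX fJ bx; exists p; exact/zeroP.
move=> [u /zeroP Ju] x; have [p Jp xp] := orbit_delta_cvg x hX fJ Ju.
by exists p => //; exact/zeroP.
Qed.
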